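(* There exist functions $n_0(k)$, $C(k)$ and a function $f(k)$ with $f(k)=o(k)$ as $k\to\infty$ (where $f$ does not depend on $n$) such that for every integer $k$ and every $n \geq n_0(k)$ divisible by $k$, $$2^{k/3-f(k)}\,n \;\leq\; \tau_{WC}(\mathcal{F}_{n,K_k\text{-fac}},1) \;\leq\; 2^k\frac{n}{k}+C(k).$$
   Context: The unbiased Waiter-Client $K_k$-factor game on $K_n$ ($n$ divisible by $k$) is played as follows. Initially all edges of the complete graph $K_n$ are unclaimed. In each round, Waiter picks two yet unclaimed edges and offers them to Client; Client chooses one of them, which is added to Client's graph, and the other is added to Waiter's graph. Waiter wins if Client's graph eventually contains a $K_k$-factor, i.e. a partition of the $n$ vertices into $n/k$ sets of size $k$ each of which spans a clique $K_k$ in Client's graph; otherwise Client wins. For $n$ large enough in terms of $k$, Waiter has a winning strategy, and $\tau_{WC}(\mathcal{F}_{n,K_k\text{-fac}},1)$ denotes the number of rounds the game lasts when Waiter plays to win as fast as possible, Client plays to delay her as long as possible, and both play optimally.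
   Formalization: The claim is made for every integer k ≥ 2 instead of every integer k: for k = 1 a K_1-factor is present from the start, so the game lasts 0 rounds and the positive lower bound fails, and for k ≤ 0 the game is not defined. *)

(* Defs.v *)
From mathcomp Require Import all_boot all_order all_algebra.
From mathcomp Require Import all_classical all_reals all_analysis.

Set Implicit Arguments.
Unset Strict Implicit.
Unset Printing Implicit Defensive.

Import Order.TTheory GRing.Theory Num.Theory.
Import numFieldNormedType.Exports.

Section WaiterClient.
Variables (T : finType) (E : {set T}) (F : {set {set T}}).

(* [WC_wins_within t C W]: on the board [E] with winning sets [F], from the    *)
(* position where Client has claimed [C] and Waiter has claimed [W], Waiter    *)
(* can force Client to own a member of [F] after at most [t] further rounds of *)
(* the unbiased Waiter-Client game. A round needs two unclaimed elements.      *)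
Fixpoint WC_wins_within (t : nat) (C W : {set T}) : Prop :=
  (exists2 S : {set T}, S \in F & S \subset C) \/
  (if t is t'.+1 then
     exists e1 e2 : T,
       [/\ e1 \in E :\: (C :|: W), e2 \in E :\: (C :|: W), e1 != e2,
           WC_wins_within t' (e1 |: C) (e2 |: W) &
           WC_wins_within t' (e2 |: C) (e1 |: W)]
   else False).

(* The optimal duration of the game; it is +oo when Waiter cannot force a win. *)
Definition tau_WC (R : realType) : \bar R :=
  ereal_inf
    [set (t%:R)%:E | t in [set t : nat | WC_wins_within t finset.set0 finset.set0]]%classic.

End WaiterClient.

Definition clique_edges (n : nat) (B : {set 'I_n}) : {set {set 'I_n}} :=
  [set e : {set 'I_n} | (e \subset B) && (#|e| == 2)].

Definition K_edges (n : nat) : {set {set 'I_n}} :=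
  clique_edges [set: 'I_n].

Definition Kk_factors (n k : nat) : {set {set {set 'I_n}}} :=
  [set (\bigcup_(B in P) clique_edges B)%SET
  | P : {set {set 'I_n}} & finset.partition P [set: 'I_n]
                           && [forall B in P, #|B| == k]].

(* Main.v *)
Require Import Defs.
From mathcomp Require Import all_boot zify.

Set Implicit Arguments.
Unset Strict Implicit.
Unset Printing Implicit Defensive.

(** Upper bound.  If no edge inside a vertex set [S] has been claimed, Waiter offers
    the edges from [v \in S] to the rest of [S] two at a time, so that [v] gets half
    of [S] as Client neighbours, and repeats this inside that half.  This yields a
    [K_k] through [v] in fewer than [2 ^ k] rounds, and every offered edge meets the
    clique, so the remaining vertices can be treated in the same way.  To finish
    exactly, Waiter first builds a large clique [Q]: each of the boundedly many
    vertices left over at the end is joined to [k - 1] vertices of [Q], and what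
    remains of [Q] is split arbitrarily.

    Lower bound.  Client plays at random.  After [t] rounds at least half of the
    cliques of a factor only have vertices of Client degree at most [D ~ 4 k t / n].
    Such a clique is described by one of its vertices and [k - 1] pairs ("the [l]-th
    Client neighbour of the [p]-th vertex"), so there are at most [n (k D)^(k - 1)]
    descriptions.  Client owns an edge between two vertices that the description
    already determines only with probability 1/2.  Growing the clique along
    Kruskal's algorithm, always describing the larger of the two components first,
    at least [(k - 1)(k - 2) / 3] edges are of this kind.  Hence the expected number of
    such cliques is too small unless [D] is at least about [2 ^ (k / 3)]. *)

Lemma exists_subset_card (T : finType) (A : {set T}) m :
  m <= #|A| -> exists2 B : {set T}, B \subset A & #|B| = m.
Proof.
move=> /card_geqP [s [us ss sA]]; exists [set x in s].
  by apply/subsetP => x; rewrite inE => /sA.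
by rewrite cardsE (card_uniqP us).
Qed.

(** * The game played towards an arbitrary goal *)

Section Reach.
Variables (T : finType) (E : {set T}).
Implicit Types (P : {set T} -> {set T} -> Prop) (C W : {set T}).

(** Same recursion as [WC_wins_within], but the goal may depend on both players' edges, so that a
    strategy can be composed of stages; each stage has to hand on which edges are still free. *)
Fixpoint reach P (t : nat) C W : Prop :=
  P C W \/
  (if t is t'.+1 then
     exists e1 e2 : T,
       [/\ e1 \in E :\: (C :|: W), e2 \in E :\: (C :|: W), e1 != e2,
           reach P t' (e1 |: C) (e2 |: W) &
           reach P t' (e2 |: C) (e1 |: W)]
   else False).

Lemma reach0 P t C W : P C W -> reach P t C W.
Proof. by case: t => [|t] /= H; left. Qed.

Lemma WC_wins_within_reach (F : {set {set T}}) t C W :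
  reach (fun C' _ => exists2 S : {set T}, S \in F & S \subset C') t C W ->
  WC_wins_within E F t C W.
Proof.
elim: t C W => [|t IH] C W /=; first by case=> //; left.
case=> [|[e1 [e2 [He1 He2 ne H1 H2]]]]; first by left.
by right; exists e1, e2; split=> //; apply: IH.
Qed.

Lemma reach_leq P t t' C W : t <= t' -> reach P t C W -> reach P t' C W.
Proof.
elim: t t' C W => [|t IH] t' C W; first by move=> _ /= [|//]; exact: reach0.
case: t' => // t' le_t /= [|[e1 [e2 [He1 He2 ne H1 H2]]]]; first by left.
by right; exists e1, e2; split=> //; apply: IH.
Qed.

(** The clause [C \subset C'] carries what Client already owns into the next stage. *)
Lemma reach_trans P P' t t' C W :
  reach P t C W ->
  (forall C' W', C \subset C' -> P C' W' -> reach P' t' C' W') ->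
  reach P' (t + t') C W.
Proof.
elim: t C W => [|t IH] C W /=; first by move=> [|//] HP /(_ C W); apply.
case=> [HP HC|[e1 [e2 [He1 He2 ne H1 H2]]] HC].
  by apply: (@reach_leq _ t' (t.+1 + t')); [rewrite leq_addl | apply: HC].
right; exists e1, e2; split=> //; apply: IH => // C' W' sC; apply: HC.
  exact: subset_trans (subsetUr _ _) sC.
exact: subset_trans (subsetUr _ _) sC.
Qed.

Lemma reach_mono P P' t C W :
  reach P t C W ->
  (forall C' W', C \subset C' -> P C' W' -> P' C' W') ->
  reach P' t C W.
Proof.
move=> H HP; rewrite -[t]addn0; apply: (reach_trans H) => C' W' sC H'.
by apply: reach0; apply: HP.
Qed.

End Reach.

(* [reverse_coercion] marks left by elaborating ['I_n] as a [finType] make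
   convertible cardinals look different to [lia]. *)
Ltac card_lia := unfold reverse_coercion in *; lia.

(** * Waiter's strategy *)

Section Strategy.
Variable n : nat.
Implicit Types (u v w : 'I_n) (S K L Q X Y U B : {set 'I_n}) (C W : {set {set 'I_n}}).

Lemma edge_in_K_edges u v : u != v -> [set u; v] \in K_edges n.
Proof. by move=> ne; rewrite inE subsetT cards2 ne. Qed.

Lemma clique_edgesP B e :
  reflect (exists u v, [/\ u \in B, v \in B, u != v & e = [set u; v]])
          (e \in clique_edges B).
Proof.
rewrite inE; apply: (iffP andP) => [[sB /cards2P [u [v [ne Ee]]]]|].
  exists u, v; move: sB; rewrite Ee subUset !sub1set => /andP [-> ->].
  by split=> //; case: ne.
by move=> [u [v [uB vB ne ->]]]; rewrite subUset !sub1set uB vB cards2 ne.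
Qed.

Lemma clique_edgesU1 v B C :
  clique_edges B \subset C -> (forall u, u \in B -> [set v; u] \in C) ->
  clique_edges (v |: B) \subset C.
Proof.
move=> /subsetP sB Hv; apply/subsetP => e /clique_edgesP [x [y [xB yB ne ->]]].
move: xB yB; rewrite !inE => /orP [/eqP Ex|xB] /orP [/eqP Ey|yB].
- by rewrite Ex Ey eqxx in ne.
- by rewrite Ex; apply: Hv.
- by rewrite Ey setUC; apply: Hv.
- by apply: sB; apply/clique_edgesP; exists x, y.
Qed.

Lemma clique_edgesS B B' : B \subset B' -> clique_edges B \subset clique_edges B'.
Proof.
move=> sB; apply/subsetP=> e; rewrite !inE => /andP [eB ->].
by rewrite (subset_trans eB sB).
Qed.

Lemma in_setU_claimed (e f g : {set 'I_n}) C W :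
  (e \in (f |: C) :|: (g |: W)) = [|| e == f, e == g | e \in C :|: W].
Proof. by rewrite !inE; do !case: (_ \in _); do !case: (_ == _). Qed.

Lemma set2_inj_r v u w : v != u -> [set v; u] = [set v; w] -> u = w.
Proof.
move=> ne E; have : u \in [set v; w] by rewrite -E !inE eqxx orbT.
by rewrite !inE eq_sym (negPf ne) => /eqP.
Qed.

(** Waiter offers the edges from [v] to two vertices of [S], and one of the two enters [S']
    whichever edge Client takes; then both are discarded from [S]. The last clause records that only
    edges between [v] and [S] get claimed. *)
Lemma reach_star m v S C W :
  v \notin S -> m.*2 <= #|S| ->
  (forall u, u \in S -> [set v; u] \notin C :|: W) ->
  reach (K_edges n) (fun C' W' => exists S',
     [/\ S' \subset S, #|S'| = m, (forall u, u \in S' -> [set v; u] \in C') &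
         forall e, e \in C' :|: W' ->
           e \in C :|: W \/ exists2 u, u \in S & e = [set v; u]]) m C W.
Proof.
elim: m S C W => [|m IH] S C W vS leS free.
  apply: reach0; exists finset.set0; rewrite sub0set cards0; split=> // [u|e].
    by rewrite inE.
  by left.
have [u1 u1S] : exists u, u \in S by apply/card_gt0P; card_lia.
have [u2 u2S] : exists u, u \in S :\ u1.
  by apply/card_gt0P; move: (cardsD1 u1 S); rewrite u1S; card_lia.
have /andP [ne u2S'] : (u2 != u1) && (u2 \in S) by rewrite !inE in u2S.
have nv x : x \in S -> v != x by apply: contraTneq => <-.
have step a b : a \in S -> b \in S -> a != b ->
  reach (K_edges n) (fun C' W' => exists S',
     [/\ S' \subset S, #|S'| = m.+1, (forall u, u \in S' -> [set v; u] \in C') &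
         forall e, e \in C' :|: W' ->
           e \in C :|: W \/ exists2 u, u \in S & e = [set v; u]])
     m ([set v; a] |: C) ([set v; b] |: W).
  move=> aS bS nab.
  have sS : S :\: [set a; b] \subset S by apply: subsetDl.
  have cS : m.*2 <= #|S :\: [set a; b]|.
    rewrite cardsD (setIidPr _) ?cards2 ?nab; first by card_lia.
    by rewrite subUset !sub1set aS.
  have vS' : v \notin S :\: [set a; b] by rewrite inE (negPf vS) andbF.
  apply: (reach_mono (IH _ _ _ vS' cS _)) => [u|].
    case/setDP=> uS uab; have /norP [ua ub] : ~~ ((u == a) || (u == b)).
      by rewrite -in_set2.
    rewrite in_setU_claimed !negb_or free // andbT.
    apply/andP; split; apply/eqP => /set2_inj_r Eu.
      by rewrite Eu ?eqxx ?nv in ua.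
    by rewrite Eu ?eqxx ?nv in ub.
  move=> C' W' sC [S' [sS' cS' HS' HC]]; exists (a |: S'); split.
  - by rewrite subUset sub1set aS (subset_trans sS' sS).
  - rewrite cardsU1 cS'; have -> : a \notin S' => //.
    by apply/negP => /(subsetP sS'); rewrite !inE eqxx.
  - move=> u; rewrite !inE => /orP [/eqP ->|]; last by apply: HS'.
    by apply: (subsetP sC); rewrite !inE eqxx.
  - move=> e /HC [|[u uS ->]]; last by right; exists u => //; apply: (subsetP sS).
    rewrite in_setU_claimed => /or3P [/eqP ->|/eqP ->|]; last by left.
      by right; exists a.
    by right; exists b.
right; exists [set v; u1], [set v; u2]; split; last first.
- by apply: step.
- by apply: step => //; rewrite eq_sym.
- by apply: contraNneq ne => /set2_inj_r ->; rewrite ?nv.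
- by rewrite inE free //= edge_in_K_edges ?nv.
- by rewrite inE free //= edge_in_K_edges ?nv.
Qed.

(* Every edge offered while building [K] meets [K]: what is left of the board
   after removing the vertices of [K] is untouched. *)
Lemma reach_clique j v S C W :
  v \in S -> 0 < j -> 2 ^ j <= #|S|.+1 ->
  (forall e, e \in clique_edges S -> e \notin C :|: W) ->
  reach (K_edges n) (fun C' W' => exists K,
     [/\ v \in K, K \subset S, #|K| = j, clique_edges K \subset C' &
         forall e, e \in C' :|: W' ->
           e \in C :|: W \/ (e \subset S) && ~~ [disjoint e & K]]) (2 ^ j).-1 C W.
Proof.
case: j => // j vS _; elim: j v S C W vS => [|j IH] v S C W vS leS free.
  apply: reach0; exists [set v]; rewrite set11 sub1set vS cards1; split=> //.
    apply/subsetP => e /clique_edgesP [x [y []]].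
    by rewrite !inE => /eqP -> /eqP ->; rewrite eqxx.
  by left.
have vS' : v \notin S :\ v by rewrite !inE eqxx.
have cS := cardsD1 v S; rewrite vS in cS.
have p2 : 0 < 2 ^ j by rewrite expn_gt0.
rewrite !expnS in leS; rewrite (_ : (2 ^ j.+2).-1 = (2 ^ j.+1).-1 + (2 ^ j.+1)); last first.
  by rewrite !expnS; card_lia.
(* The sizes [2 ^ j - 1] are stable under removing [v] and halving, so the hypothesis with [#|S|.+1]
   reproduces itself for the Client neighbours of [v]. *)
have leS' : ((2 ^ j.+1).-1).*2 <= #|S :\ v| by rewrite expnS; card_lia.
apply: (reach_trans (reach_star (m := (2 ^ j.+1).-1) vS' leS' _)) => [u|].
  case/setD1P=> nu uS; apply: free; apply/clique_edgesP.
  by exists v, u; rewrite eq_sym.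
move=> C1 W1 sC1 [S1 [sS1 cS1 HS1 HC1]].
have [w wS1] : exists u, u \in S1.
  by apply/card_gt0P; rewrite cS1 expnS; card_lia.
have S1S : S1 \subset S by apply: subset_trans sS1 (subsetDl _ _).
have vS1 : v \notin S1 by apply: contra vS' => /(subsetP sS1).
have cS1' : 2 ^ j.+1 <= #|S1|.+1 by rewrite cS1; card_lia.
apply: (@reach_leq _ _ _ (2 ^ j.+1).-1); first by card_lia.
apply: (reach_mono (IH w S1 C1 W1 wS1 cS1' _)) => [e eS1|].
  apply/negP => /HC1 [H|[u uS Ee]].
    by move/negP: (free e (subsetP (clique_edgesS S1S) _ eS1)); apply.
  move: eS1 vS1; rewrite inE Ee subUset sub1set => /andP [/andP [-> _] _] //.
move=> C2 W2 sC2 [K [wK sK cK HK HC2]]; exists (v |: K); split.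
- by rewrite !inE eqxx.
- by rewrite subUset sub1set vS (subset_trans sK S1S).
- by rewrite cardsU1 cK (contra _ vS1) //; apply: (subsetP sK).
- apply: clique_edgesU1 => // u uK; apply: (subsetP sC2).
  by apply: HS1; apply: (subsetP sK).
move=> e /HC2 [/HC1 [|[u uS ->]]|/andP [eS1 nd]]; first by left.
  right; rewrite subUset !sub1set vS; move: uS; rewrite inE => /andP [_ ->] /=.
  by apply/pred0Pn; exists v; rewrite !inE eqxx.
right; rewrite (subset_trans eS1 S1S) /=.
case/pred0Pn: nd => x /andP [/= xe xK]; apply/pred0Pn; exists x.
by rewrite /= !inE xe xK orbT.
Qed.

(** * Assembling a clique factor *)

Variable k : nat.

Definition has_factor U C :=
  exists P : {set {set 'I_n}},
    [/\ partition P U, (forall B, B \in P -> #|B| = k) &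
        forall B, B \in P -> clique_edges B \subset C].

Lemma has_factorU K U C C' :
  0 < k -> C \subset C' -> [disjoint K & U] -> #|K| = k -> clique_edges K \subset C ->
  has_factor U C' -> has_factor (K :|: U) C'.
Proof.
move=> k0 sC dKU cK HK [P [pP sP cP]].
have KP : K \notin P.
  apply/negP => KP; have := partitionS pP KP => sKU.
  move: dKU; rewrite disjoints_subset => /subsetP dK.
  have [x xK] : exists x, x \in K by apply/card_gt0P; rewrite cK.
  by have := dK _ xK; rewrite inE (subsetP sKU).
exists (K |: P); split.
- have [/eqP covP tiP nP] := and3P pP.
  apply/and3P; split.
  + by rewrite /cover bigcup_setU big_set1 -covP.
  + rewrite -[K |: P]/([set K] :|: P); apply/trivIsetP => A B.
    move: dKU; rewrite -covP => /bigcup_disjointP dK.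
    rewrite !inE => /orP [/eqP ->|AP] /orP [/eqP ->|BP] nAB.
    * by rewrite eqxx in nAB.
    * by apply: dK.
    * by rewrite disjoint_sym; apply: dK.
    * by apply: (trivIsetP tiP).
  + rewrite !inE negb_or nP andbT; apply/eqP => E.
    by rewrite -E cards0 in cK; rewrite -cK in k0.
- by move=> B; rewrite !inE => /orP [/eqP ->|/sP].
- move=> B; rewrite !inE => /orP [/eqP ->|/cP //].
  exact: subset_trans HK sC.
Qed.

Lemma has_factor_clique Q C :
  0 < k -> k %| #|Q| -> clique_edges Q \subset C -> has_factor Q C.
Proof.
move=> k0; move Em : #|Q| => m /dvdnP [q Eq]; rewrite {m}Eq in Em.
elim: q Q Em => [|q IH] Q cQ HQ.
  move/eqP: cQ; rewrite mul0n cards_eq0 => /eqP ->.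
  exists finset.set0; rewrite partition_set0 eqxx; split=> // B; by rewrite inE.
have [|K KQ cK] := exists_subset_card (A := Q) (m := k); first by rewrite cQ; card_lia.
have sKQ : clique_edges K \subset C by apply: subset_trans HQ; apply: clique_edgesS.
have -> : Q = K :|: Q :\: K by rewrite setDE setUIr setUCr setIT (setUidPr KQ).
apply: has_factorU => //; first by rewrite disjoint_sym disjoints_subset subsetDr.
apply: IH.
  by rewrite cardsD (setIidPr KQ) cQ cK; card_lia.
by apply: subset_trans HQ; apply: clique_edgesS; apply: subsetDl.
Qed.

(** Each vertex of [L] plays a star into [Q]; since [Q] is a clique, the [k.-1] neighbours won
    complete a block. They leave [Q], and what finally remains of [Q] is split arbitrarily. *)
Lemma reach_factor_absorb Q L C W :
  0 < k -> [disjoint L & Q] -> clique_edges Q \subset C ->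
  k %| #|Q| + #|L| -> (k.-1 * #|L|).*2 <= #|Q| ->
  (forall u v, u \in L -> v \in Q -> [set u; v] \notin C :|: W) ->
  reach (K_edges n) (fun C' _ => has_factor (Q :|: L) C') (k.-1 * #|L|) C W.
Proof.
move=> k0; move Em : #|L| => m; elim: m L Q C W Em => [|m IH] L Q C W cL dLQ HQ dk leQ free.
  move/eqP: cL; rewrite cards_eq0 => /eqP ->; rewrite setU0; apply: reach0.
  by apply: has_factor_clique; rewrite // -[#|Q|]addn0.
have [w wL] : exists w, w \in L by apply/card_gt0P; rewrite cL.
have wQ : w \notin Q by move: dLQ; rewrite disjoints_subset => /subsetP /(_ _ wL); rewrite inE.
rewrite mulnS; apply: (reach_trans (reach_star (m := k.-1) wQ _ _)).
- by apply: leq_trans leQ; rewrite leq_double mulnS leq_addr.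
- by move=> u uQ; apply: free.
move=> C' W' sC [S [sS cS HS HC]].
have wS : w \notin S by apply: contra wQ => /(subsetP sS).
have eU : Q :|: L = (w |: S) :|: ((Q :\: S) :|: (L :\ w)).
  apply/setP => x; rewrite !inE; case: eqP => [->|_] /=; first by rewrite wL orbT.
  by case: (boolP (x \in S)) => //= /(subsetP sS) ->.
rewrite eU; have cw := cardsD1 w L; rewrite wL cL in cw.
have cD : #|Q :\: S| = #|Q| - k.-1 by rewrite cardsD (setIidPr sS) cS.
have leQ1 : (k.-1 * m).*2 + k.-1 <= #|Q|.
  by apply: leq_trans leQ; rewrite mulnS -!addnn; move: (k.-1 * m) k.-1 => x y; lia.
apply: (reach_mono (IH (L :\ w) (Q :\: S) C' W' _ _ _ _ _ _)).
- by card_lia.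
- apply: disjointWl (subsetDl _ _) _; apply: disjointWr (subsetDl _ _) _; exact: dLQ.
- by apply: subset_trans sC; apply: subset_trans HQ; apply: clique_edgesS; apply: subsetDl.
- rewrite cD; have -> : #|Q| - k.-1 + m = #|Q| + m.+1 - k.
    have := leq_trans (leq_addl _ _) leQ1; move: #|Q| => x; lia.
  by apply: dvdn_sub => //.
- by rewrite cD leq_subRL ?(leq_trans (leq_addl _ _) leQ1) // addnC.
- move=> u v; rewrite !inE => /andP [uw uL] /andP [vS vQ]; rewrite -in_setU.
  apply/negP => /HC [|[x xQ]]; first by apply/negP; apply: free.
  move=> E; have : u \in [set w; x] by rewrite -E !inE eqxx.
  rewrite !inE (negPf uw) => /eqP ux; move: dLQ; rewrite disjoints_subset.
  by move/subsetP/(_ _ uL); rewrite inE ux xQ.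
move=> C2 W2 sC2; apply: (@has_factorU (w |: S) _ C') => //.
- rewrite disjoints_subset; apply/subsetP => x; rewrite !inE.
  case/orP => [/eqP ->|xS]; first by rewrite (negPf wQ) eqxx /= andbF.
  rewrite xS /=; apply/negP => /andP [_ xL]; move: dLQ.
  by rewrite disjoints_subset => /subsetP/(_ _ xL); rewrite inE (subsetP sS).
- by rewrite cardsU1 wS cS; card_lia.
- apply: clique_edgesU1 => //; apply: subset_trans sC; apply: subset_trans HQ.
  exact: clique_edgesS.
Qed.

(** [Q] is the reserve clique, [Y] the rest of the set in which it was built, [X] the untouched
    vertices. Edges between [Y] and [Q] may be claimed, so [Y] cannot be absorbed; its vertices are
    covered first, by cliques whose other vertices lie in [X]. *)
Lemma reach_factor_loop Q Y X C W :
  1 < k -> [disjoint Q & Y] -> [disjoint Q & X] -> [disjoint Y & X] ->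
  clique_edges Q \subset C -> k %| #|Q| + (#|Y| + #|X|) ->
  (k.-1 * 2 ^ k).*2 <= #|Q| -> (Y != finset.set0 -> k * #|Y| + 2 ^ k <= #|X|) ->
  (forall u v, u \in X -> v \in Q :|: Y :|: X -> u != v -> [set u; v] \notin C :|: W) ->
  reach (K_edges n) (fun C' _ => has_factor (Q :|: (Y :|: X)) C')
        (2 ^ k * ((#|Y| + #|X|) %/ k) + k.-1 * 2 ^ k) C W.
Proof.
move=> k1; move Em : (#|Y| + #|X|) => m.
elim/ltn_ind: m X Y C W Em => m IH X Y C W cXY dQY dQX dYX HQ dk leQ leX free.
have k0 : 0 < k by card_lia.
(* The loop stops when [Y] is exhausted and [X] is too small to guarantee another clique. *)
have [/andP [/eqP Y0 ltX]|big] := boolP ((Y == finset.set0) && (#|X| < 2 ^ k)).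
  rewrite Y0 cards0 add0n in cXY *; rewrite set0U.
  have leXk : k.-1 * #|X| <= k.-1 * 2 ^ k by rewrite leq_mul2l ltnW ?orbT.
  apply: (@reach_leq _ _ _ (k.-1 * #|X|)); first exact: leq_trans leXk (leq_addl _ _).
  apply: reach_factor_absorb => //.
  - by rewrite disjoint_sym.
  - by rewrite cXY.
  - by apply: leq_trans leQ; rewrite leq_double.
  - move=> u v uX vQ; apply: free => //; first by rewrite !inE vQ.
    by apply: contraTneq vQ => <-; move: dQX; rewrite disjoint_sym disjoints_subset
      => /subsetP /(_ _ uX); rewrite inE.
have [w [wYX cwX]] : exists w, w \in Y :|: X /\
    2 ^ k <= #|w |: X|.+1 /\ (Y != finset.set0 -> w \in Y).
  have [Y0|Y0] := boolP (Y == finset.set0).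
    rewrite Y0 /= -leqNgt in big.
    have [w wX] : exists w, w \in X.
      by apply/card_gt0P; apply: leq_trans big; rewrite expn_gt0.
    exists w; rewrite inE wX orbT (setUidPr _) ?sub1set //; split=> //.
    by split; [exact: leqW | case/negP].
  have [w wY] := set0Pn _ Y0.
  exists w; rewrite inE wY; split=> //; split=> //.
  by have := leX Y0; rewrite cardsU1; card_lia.
case: cwX => cwX wY.
have dXY x : x \in X -> x \notin Y.
  by move=> xX; move: dYX; rewrite disjoint_sym disjoints_subset => /subsetP /(_ _ xX); rewrite inE.
have dXQ x : x \in Y :|: X -> x \notin Q.
  by rewrite inE => /orP [] xX;
    [move: dQY|move: dQX]; rewrite disjoint_sym disjoints_subset => /subsetP /(_ _ xX); rewrite inE.
have leKm : k <= m.
  have k2 : k <= 2 ^ k by apply: ltnW; apply: ltn_expl.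
  apply: leq_trans k2 _; rewrite -cXY; apply: leq_trans (leq_addl _ _).
  have [Y0|/leX] := eqVneq Y finset.set0; last exact: leq_trans (leq_addl _ _).
  by move: big; rewrite Y0 eqxx /= -leqNgt.
have -> : 2 ^ k * (m %/ k) + k.-1 * 2 ^ k
        = 2 ^ k + (2 ^ k * ((m - k) %/ k) + k.-1 * 2 ^ k).
  have -> : m %/ k = ((m - k) %/ k).+1.
    by rewrite -{1}(subnK leKm) divnDr // divnn k0 addn1.
  by rewrite mulnS addnA.
have wS : w \in w |: X by rewrite !inE eqxx.
apply: (reach_trans (t := 2 ^ k)).
  apply: (@reach_leq _ _ _ (2 ^ k).-1); first exact: leq_pred.
  apply: (reach_clique (j := k) wS k0 cwX) => e /clique_edgesP [x [y []]].
  rewrite !inE => xS yS nxy ->; rewrite -in_setU.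
  have [xX|xX] := boolP (x \in X).
    apply: free => //; rewrite !inE -orbA; case/orP: yS => [/eqP ->|->].
      by move: wYX; rewrite inE => ->; rewrite orbT.
    by rewrite !orbT.
  rewrite (negPf xX) orbF in xS; rewrite setUC; apply: free; last by rewrite eq_sym.
    by case/orP: yS => // /eqP Ey; rewrite Ey (eqP xS) eqxx in nxy.
  by move: wYX; rewrite (eqP xS) !inE -orbA => ->; rewrite orbT.
move=> C' W' sC [K [wK sK cK HK HC]].
have KYX : K \subset Y :|: X.
  by apply: subset_trans sK _; rewrite subUset sub1set wYX subsetUr.
have eU : Q :|: (Y :|: X) = K :|: (Q :|: ((Y :\: K) :|: (X :\: K))).
  apply/setP => x; rewrite !inE; have [xK|] //= := boolP (x \in K).
  by have := subsetP KYX _ xK; rewrite !inE => ->; rewrite orbT.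
have cYX : #|Y :\: K| + #|X :\: K| = m - k.
  have e1 : #|Y :|: X| = m by rewrite cardsU disjoint_setI0 // cards0 -cXY subn0.
  have e2 : #|(Y :|: X) :\: K| = m - k by rewrite cardsD (setIidPr KYX) e1 cK.
  rewrite -e2 setDUl cardsU disjoint_setI0 ?cards0 ?subn0 //.
  by apply: disjointWl (subsetDl _ _) _; apply: disjointWr (subsetDl _ _) dYX.
rewrite eU.
apply: (reach_mono (IH (m - k) _ (X :\: K) (Y :\: K) C' W' cYX _ _ _ _ _ _ _ _)).
- by rewrite ltn_subrL k0 (leq_trans k0 leKm).
- by apply: disjointWr (subsetDl _ _) dQY.
- by apply: disjointWr (subsetDl _ _) dQX.
- by apply: disjointWl (subsetDl _ _) _; apply: disjointWr (subsetDl _ _) dYX.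
- exact: subset_trans HQ sC.
- by rewrite addnBA //; apply: dvdn_sub.
- by [].
(* The clique takes [w] from [Y] and at most [k] vertices from [X], so both sides of the size
   condition drop compatibly. *)
- move=> nY; have Y0 : Y != finset.set0 by apply: contraNneq nY => ->; rewrite set0D.
  have wY' := wY Y0.
  have cY : #|Y :\: K| < #|Y|.
    apply: proper_card; apply/properP; split; first exact: subsetDl.
    by exists w; rewrite // inE wK.
  have cX : #|X| <= #|X :\: K| + k.
    by rewrite -(cardsID K X) addnC leq_add2l -cK subset_leq_card // subsetIr.
  rewrite -(leq_add2r k); apply: leq_trans cX; apply: leq_trans (leX Y0).
  by rewrite addnAC -mulnSr leq_add2r leq_mul2l cY orbT.
- move=> u v; rewrite !inE => /andP [uK uX] vU nuv; rewrite -in_setU.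
  have vK : v \notin K.
    apply/negP => vK; move: vU; rewrite vK /= !orbF => vQ.
    by have := dXQ _ (subsetP KYX _ vK); rewrite vQ.
  apply/negP => /HC [|/andP [_ /pred0Pn [x /andP [/=]]]].
    apply/negP; apply: free => //; rewrite !inE.
    by move: vU; rewrite vK.
  by rewrite !inE => /orP [] /eqP ->; apply/negP.
move=> C2 W2 sC2; apply: (@has_factorU K _ C') => //.
rewrite disjoints_subset; apply/subsetP => x xK; rewrite !inE xK /=.
by rewrite !orbF; apply: dXQ; apply: (subsetP KYX).
Qed.

End Strategy.

(** At the end fewer than [2 ^ k] vertices remain, each needing [k.-1] vertices of the reserve
    clique; the doubling is there because a star wins only one of the two edges offered in a
    round. *)
Definition absorber_size k := (k.-1 * 2 ^ k).*2.

(** A set of [2 ^ absorber_size k] vertices is used up to build the reserve clique; the other two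
    terms of the threshold leave enough vertices outside to cover the rest of that set. *)
Lemma Kk_factor_within n k : 1 < k -> k %| n ->
  k * 2 ^ absorber_size k + 2 ^ absorber_size k + 2 ^ k <= n ->
  WC_wins_within (K_edges n) (Kk_factors n k)
    (2 ^ absorber_size k + (2 ^ k * (n %/ k) + k.-1 * 2 ^ k)) finset.set0 finset.set0.
Proof.
move=> k1 dk; set M := absorber_size k => len.
apply: WC_wins_within_reach.
have p2 : 0 < 2 ^ M by rewrite expn_gt0.
have k2 : 0 < 2 ^ k by rewrite expn_gt0.
have [ltk ltM] : k < 2 ^ k /\ M < 2 ^ M by split; apply: ltn_expl.
have M0 : 0 < M by rewrite /M /absorber_size double_gt0 muln_gt0 k2 andbT -ltnS prednK // ltnW.
have leM : 2 ^ M <= n by apply: leq_trans len; rewrite -addnA addnCA leq_addr.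
have lenM : k * 2 ^ M + 2 ^ k <= n - 2 ^ M by rewrite leq_subRL // addnA [2 ^ M + _]addnC.
have [|S _ cS] := @exists_subset_card _ [set: 'I_n] (2 ^ M).
  by rewrite cardsT card_ord.
have [v vS] : exists v, v \in S by apply/card_gt0P; rewrite cS.
apply: (reach_trans (t := 2 ^ M)).
  apply: (@reach_leq _ _ _ (2 ^ M).-1); first exact: leq_pred.
  apply: (reach_clique (j := M) vS M0); first by rewrite cS.
  by move=> e _; rewrite !inE.
move=> C W _ [Q [vQ sQ cQ HQ HC]].
have cQS : #|S :\: Q| = 2 ^ M - M by rewrite cardsD (setIidPr sQ) cS cQ.
have cX : #|~: S| = n - 2 ^ M by rewrite cardsCs setCK cS card_ord.
have cYX : #|S :\: Q| + #|~: S| = n - M.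
  by rewrite cQS cX addnC addnBA ?(ltnW ltM) // subnK.
apply: (@reach_leq _ _ _ (2 ^ k * ((n - M) %/ k) + k.-1 * 2 ^ k)).
  by rewrite leq_add2r leq_mul2l leq_div2r ?orbT // leq_subr.
have eT : [set: 'I_n] = Q :|: ((S :\: Q) :|: ~: S).
  by apply/setP => x; rewrite !inE; case: (x \in Q); case: (x \in S).
rewrite -cYX; apply: (reach_mono (P := fun C' _ => has_factor k [set: 'I_n] C')).
  rewrite eT; apply: reach_factor_loop => //.
  - by rewrite disjoint_sym disjoints_subset subsetDr.
  - by rewrite disjoints_subset setCK.
  - by rewrite disjoints_subset setCK subsetDl.
  - by rewrite cYX cQ subnKC // (leq_trans (ltnW ltM) leM).
  - by rewrite cQ.
  - move=> _; rewrite cQS cX; apply: leq_trans lenM.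
    by rewrite leq_add2r leq_mul2l leq_subr orbT.
  - move=> u w; rewrite !inE => uS _ nuw; rewrite -in_setU.
    apply/negP => /HC [|/andP [sS _]]; first by rewrite !inE.
    by move: sS; rewrite subUset sub1set (negPf uS).
move=> C' _ _ [P [pP sP cP]].
exists (\bigcup_(B in P) clique_edges B).
  by apply/imsetP; exists P => //; rewrite inE pP; apply/forall_inP => B /sP ->.
by apply/bigcupsP.
Qed.

(** * Lower bound: a randomly playing Client *)

Section Potential.
Variables (T : finType) (E : {set T}) (F : {set {set T}}).
Variables (phi : seq T -> {set T} -> nat) (L N : nat).

Definition play_inv (h : seq T) (W : {set T}) :=
  [/\ {subset h <= E}, W \subset E & forall e, e \in h -> e \notin W].

Hypothesis phi_step : forall h W e1 e2, play_inv h W -> e1 != e2 ->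
  e1 \in E -> e2 \in E ->
  phi (e1 :: h) (e2 |: W) + phi (e2 :: h) (e1 |: W) <= 2 * phi h W.
Hypothesis phi_win : forall h W S, play_inv h W -> size h <= N ->
  S \in F -> {subset S <= h} -> L <= phi h W.

Lemma play_inv_cons h W e1 e2 : play_inv h W -> e1 != e2 ->
  e1 \in E :\: ([set e in h] :|: W) -> e2 \in E :\: ([set e in h] :|: W) ->
  play_inv (e1 :: h) (e2 |: W).
Proof.
move=> [hE WE hW] ne; rewrite !inE !negb_or.
move=> /andP [/andP [_ e1W] e1E] /andP [/andP [e2h e2W] e2E]; split.
- by move=> e; rewrite inE => /orP [/eqP ->|/hE].
- by rewrite subUset sub1set e2E.
move=> e; rewrite !inE negb_or => /orP [/eqP ->|eh]; first by rewrite ne.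
by rewrite hW // andbT; apply: contraNneq e2h => <-.
Qed.

(** [phi] is a supermartingale for a Client flipping fair coins. Both answers of Client leave Waiter
    a win, so by induction both values of [phi] are at least [L], and hence so is their average,
    which [phi h W] dominates. *)
Lemma WC_potential t h W : play_inv h W -> size h + t <= N ->
  WC_wins_within E F t [set e in h] W -> L <= phi h W.
Proof.
elim: t h W => [|t IH] h W inv sz.
  case=> // [[S SF sS]]; apply: (phi_win inv _ SF); first by rewrite -(addn0 (size h)).
  by move=> e /(subsetP sS); rewrite inE.
case=> [[S SF sS]|[e1 [e2 [He1 He2 ne H1 H2]]]].
  apply: (phi_win inv _ SF); first by apply: leq_trans sz; rewrite leq_addr.
  by move=> e /(subsetP sS); rewrite inE.
have cE e : e |: [set e in h] = [set x in e :: h] by apply/setP => x; rewrite !inE.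
rewrite !cE in H1 H2.
have L1 : L <= phi (e1 :: h) (e2 |: W).
  by apply: IH => //; [exact: play_inv_cons | rewrite /= addSnnS].
have L2 : L <= phi (e2 :: h) (e1 |: W).
  by apply: IH => //; [apply: play_inv_cons; rewrite // eq_sym | rewrite /= addSnnS].
have := phi_step inv ne; move: He1 He2; rewrite !inE => /andP [_ ->] /andP [_ ->].
move=> /(_ isT isT); move/(leq_trans (leq_add L1 L2)).
by rewrite addnn -mul2n leq_pmul2l.
Qed.

End Potential.

Lemma onth_prefix (T : eqType) (s1 s2 : seq T) i x :
  prefix s1 s2 -> onth s1 i = Some x -> onth s2 i = Some x.
Proof.
move=> /prefixP [s ->] H; rewrite onth_cat; case: ltnP => // le_i.
by move: H; rewrite onth_default.
Qed.

Lemma onth_index (T : eqType) (s : seq T) x : x \in s -> onth s (index x s) = Some x.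
Proof.
by move=> xs; rewrite onthE (nth_map x) ?index_mem // nth_index.
Qed.

Lemma prefix_subset (T : eqType) (s1 s2 : seq T) : prefix s1 s2 -> {subset s1 <= s2}.
Proof. by move=> /prefixP [s ->] x xs; rewrite mem_cat xs. Qed.

(** * Naming vertices through Client's history *)

Section Decode.
Variable V : finType.
Implicit Types (h : seq {set V}) (acc : seq V) (c : seq (nat * nat)) (K A B : {set V}).

(* Histories list Client's edges with the most recent one first; [nbrs] is in
   chronological order, so it only grows at its end as the game goes on. *)
Definition other_end (v : V) (e : {set V}) : V := odflt v [pick w in e :\ v].
Definition nbrs h v : seq V := rev [seq other_end v e | e : {set V} <- h & v \in e].

(* A pair [(p, l)] names the [l]-th Client neighbour of the [p]-th vertex decoded
   so far; decoding stops at the first name not yet defined. *)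
Fixpoint decode h acc c : seq V :=
  if c is (p, l) :: c' then
    if onth acc p is Some u then
      if onth (nbrs h u) l is Some w then decode h (rcons acc w) c' else acc
    else acc
  else acc.

Lemma nbrs_cons e h v : prefix (nbrs h v) (nbrs (e :: h) v).
Proof.
rewrite /nbrs /=; case: ifP => _ /=; last by rewrite prefix_refl.
by rewrite rev_cons prefix_rcons.
Qed.

Lemma decode_acc h acc c : prefix acc (decode h acc c).
Proof.
elim: c acc => [|[p l] c IH] acc /=; first exact: prefix_refl.
case: (onth acc p) => [u|]; last exact: prefix_refl.
case: (onth _ l) => [w|]; last exact: prefix_refl.
exact: prefix_trans (prefix_rcons _ _) (IH _).
Qed.

(** Neighbour lists grow only at their ends, so a defined name keeps its meaning and a new edge can
    only prolong the decoded sequence. *)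
Lemma decode_cons e h acc c : prefix (decode h acc c) (decode (e :: h) acc c).
Proof.
elim: c acc => [|[p l] c IH] acc; first exact: prefix_refl.
rewrite /=; case: (onth acc p) => [u|]; last exact: prefix_refl.
case E: (onth (nbrs h u) l) => [w|].
  by rewrite (onth_prefix (nbrs_cons e h u) E).
case: (onth _ l) => [w|]; last exact: prefix_refl.
exact: prefix_trans (prefix_rcons _ w) (decode_acc _ _ _).
Qed.

Lemma decode_subset e h acc c :
  {subset decode h acc c <= decode (e :: h) acc c}.
Proof. exact: prefix_subset (decode_cons _ _ _ _). Qed.

Lemma size_decode h acc c : size (decode h acc c) <= size acc + size c.
Proof.
elim: c acc => [|[p l] c IH] acc /=; first by rewrite addn0.
case: (onth acc p) => [u|]; last by rewrite leq_addr.
case: (onth _ l) => [w|]; last by rewrite leq_addr.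
by apply: leq_trans (IH _) _; rewrite size_rcons addSnnS.
Qed.

Lemma prefix_size_eq (T : eqType) (s1 s2 : seq T) :
  prefix s1 s2 -> size s2 <= size s1 -> s1 = s2.
Proof.
move=> /prefixP [s ->]; rewrite size_cat -{2}(addn0 (size s1)) leq_add2l leqn0.
by move/nilP => ->; rewrite cats0.
Qed.

(** When every name is defined there is nothing left to prolong. *)
Lemma decode_full e h acc c :
  size (decode h acc c) = size acc + size c ->
  decode (e :: h) acc c = decode h acc c.
Proof.
move=> sz; apply/esym/prefix_size_eq; first exact: decode_cons.
by rewrite sz size_decode.
Qed.

Lemma decode_full_cat h' h acc c :
  size (decode h acc c) = size acc + size c ->
  decode (h' ++ h) acc c = decode h acc c.
Proof. by move=> sz; elim: h' => //= e h' IH; rewrite decode_full IH. Qed.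

Lemma prefix_decode_cat h acc c c' :
  prefix (decode h acc c) (decode h acc (c ++ c')).
Proof.
elim: c acc => [|[p l] c IH] acc /=; first exact: decode_acc.
case: (onth acc p) => [u|]; last exact: prefix_refl.
case: (onth _ l) => [w|]; [exact: IH | exact: prefix_refl].
Qed.

Lemma decode_cat_full h acc c c' :
  size (decode h acc c) = size acc + size c ->
  decode h acc (c ++ c') = decode h (decode h acc c) c'.
Proof.
elim: c acc => [|[p l] c IH] acc //=.
case: (onth acc p) => [u|]; last by move=> /= H; exfalso; lia.
case: (onth _ l) => [w|]; last by move=> /= H; exfalso; lia.
by move=> H; apply: IH; rewrite H size_rcons addSnnS.
Qed.

(** The edges whose two ends the code determined before Client took them: the test uses the history
    [h'] preceding [e]. These are the coin flips that a random Client has to win. *)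
Fixpoint late h (r : V) c : seq {set V} :=
  if h is e :: h' then
    if e \subset decode h' [:: r] c then e :: late h' r c else late h' r c
  else [::].

Lemma mem_late h2 h1 r c (e : {set V}) :
  e \subset decode h1 [:: r] c -> e \in late (h2 ++ e :: h1) r c.
Proof.
move=> He; elim: h2 => /= [|f h2 IH]; first by rewrite He inE eqxx.
by case: ifP => _ //; rewrite inE IH orbT.
Qed.

Lemma late_cat_sub h r c c' : {subset late h r c <= late h r (c ++ c')}.
Proof.
elim: h => //= e h IH x; case: ifP => He; last first.
  by move/IH => H; case: ifP => _ //; rewrite inE H orbT.
have -> : e \subset decode h [:: r] (c ++ c').
  apply/subsetP => y /(subsetP He).
  exact: (prefix_subset (prefix_decode_cat _ _ _ _)).
by rewrite !inE => /orP [->//|/IH ->]; rewrite orbT.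
Qed.

(** The inverse of the probability of winning all late coin flips so far, and zero once one of the
    edges inside the decoded set is lost to Waiter. *)
Definition weight h (W : {set {set V}}) r c :=
  if [forall e in W, ~~ (e \subset decode h [:: r] c)] then 2 ^ size (late h r c) else 0.

(** If both offered edges lie inside the decoded set, both outcomes give zero; if just one does, the
    weight at most doubles or vanishes; if none does, it cannot grow, but may vanish when the
    decoded set grows. *)
Lemma weight_step h W r c e1 e2 : e1 != e2 ->
  weight (e1 :: h) (e2 |: W) r c + weight (e2 :: h) (e1 |: W) r c <= 2 * weight h W r c.
Proof.
move=> ne.
have mono e f : weight (e :: h) (f |: W) r c <=
    if f \subset decode h [:: r] c then 0 else
    (if e \subset decode h [:: r] c then 2 else 1) * weight h W r c.
  have sub (g : {set V}) : g \subset decode h [:: r] c -> g \subset decode (e :: h) [:: r] c.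
    by move=> /subsetP H; apply/subsetP => x /H; apply: decode_subset.
  rewrite /weight; case: ifP => [/forall_inP H|_] //.
  have /negPf -> : ~~ (f \subset decode h [:: r] c).
    by apply/negP => /sub; apply/negP; apply: H; rewrite setU11.
  have -> : [forall e in W, ~~ (e \subset decode h [:: r] c)].
    apply/forall_inP => g gW; apply/negP => /sub; apply/negP; apply: H.
    by rewrite !inE gW orbT.
  by rewrite /=; case: ifP => _ //=; rewrite ?mul1n // expnS.
move: (mono e1 e2) (mono e2 e1).
move: (weight _ (e2 |: W) r c) (weight _ (e1 |: W) r c) (weight h W r c) => x y z.
by case: (e1 \subset _); case: (e2 \subset _) => H1 H2; lia.
Qed.

(** * Codes of cliques, following Kruskal's algorithm in time *)

Definition connected_in K h :=
  forall A, A \subset K -> A != finset.set0 -> A != K ->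
  exists a b, [/\ a \in A, b \in K :\: A & [set a; b] \in h].

Definition code_bounded k D c := all (fun q => (q.1 < k) && (q.2 < D)) c.

Lemma other_endE u w : u != w -> other_end u [set u; w] = w.
Proof.
move=> ne; rewrite /other_end; case: pickP => [x|/(_ w)].
  by rewrite !inE => /andP [/negPf -> /=] /eqP.
by rewrite !inE eqxx orbT eq_sym ne.
Qed.

Lemma mem_nbrs h u w : u != w -> [set u; w] \in h -> w \in nbrs h u.
Proof.
move=> ne uw; rewrite /nbrs mem_rev; apply/mapP; exists [set u; w].
  by rewrite mem_filter uw !inE eqxx.
by rewrite other_endE.
Qed.

Lemma size_nbrs h u : size (nbrs h u) = count (fun e : {set V} => u \in e) h.
Proof. by rewrite size_rev size_map size_filter. Qed.

(** Connectivity supplies an edge leaving the decoded set; the position of its inner end and the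
    rank of its outer end among the neighbours of the inner one form the next pair. *)
Lemma decode_extend D h K acc :
  connected_in K h -> (forall v, v \in K -> size (nbrs h v) <= D) ->
  uniq acc -> acc != [::] -> {subset acc <= K} ->
  exists c, [/\ code_bounded #|K| D c, size (decode h acc c) = size acc + size c,
                uniq (decode h acc c) & decode h acc c =i K].
Proof.
move=> conn deg; move Em : (#|K| - size acc) => m.
elim: m acc Em => [|m IH] acc Em ua n0 sub.
  have Eacc : acc =i K.
    have le : size acc <= #|K| by rewrite -(card_uniqP ua); apply/subset_leq_card/subsetP.
    apply/subset_cardP; last by apply/subsetP.
    by rewrite (card_uniqP ua); lia.
  by exists [::]; rewrite addn0.
have [|||a [b [aA bA ab]]] := conn [set x in acc].
- by apply/subsetP => x; rewrite inE; apply: sub.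
- by case: acc n0 {IH Em ua sub} => // x acc _; apply/set0Pn; exists x; rewrite !inE eqxx.
- apply/eqP => E; have := card_uniqP ua; rewrite -E cardsE in Em.
  by move=> H; rewrite H subnn in Em.
rewrite inE in aA; move: bA; rewrite !inE => /andP [bacc bK].
have nab : a != b by apply: contraNneq bacc => <-.
have bn := mem_nbrs nab ab.
have [c [bc sc uc Ec]] : exists c, [/\ code_bounded #|K| D c,
   size (decode h (rcons acc b) c) = size (rcons acc b) + size c,
   uniq (decode h (rcons acc b) c) & decode h (rcons acc b) c =i K].
  apply: IH.
  - by rewrite size_rcons; lia.
  - by rewrite rcons_uniq bacc.
  - by case: (acc).
  - by move=> x; rewrite mem_rcons inE => /orP [/eqP ->|/sub].
have E : decode h acc ((index a acc, index b (nbrs h a)) :: c) = decode h (rcons acc b) c.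
  by rewrite /= !onth_index.
exists ((index a acc, index b (nbrs h a)) :: c); rewrite E; split=> //=.
- rewrite bc andbT; apply/andP; split.
    apply: leq_trans (_ : size acc <= _); first by rewrite index_mem.
    by rewrite -(card_uniqP ua); apply/subset_leq_card/subsetP.
  apply: leq_trans (_ : size (nbrs h a) <= _); first by rewrite index_mem.
  by apply: deg; apply: sub.
- by rewrite sc size_rcons addSnnS.
Qed.

Lemma connected_nil K : connected_in K [::] -> K != finset.set0 -> exists r, K = [set r].
Proof.
move=> conn /set0Pn [r rK]; exists r; apply/eqP.
have [//|ne] := eqVneq K [set r].
have [||| a [b [_ _]] //] := conn [set r].
- by rewrite sub1set.
- by apply/set0Pn; exists r; rewrite set11.
- by rewrite eq_sym.
Qed.

Definition cut K A h := forall a b, a \in A -> b \in K :\: A -> [set a; b] \notin h.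

(** Only [e] crosses the cut, and it meets [A] in a single vertex [a]. A part of [A] avoiding [a]
    therefore has its outgoing edge in [h] and inside [A]; a part containing [a] is handled through
    its complement. *)
Lemma connected_side K A e h :
  A \subset K -> connected_in K (e :: h) -> cut K A h ->
  A != finset.set0 -> A != K -> connected_in A h.
Proof.
move=> sAK conn cutA A0 AK.
have [a [b [aA bB]]] := conn A sAK A0 AK.
rewrite inE (negPf (cutA _ _ aA bB)) orbF => /eqP Ee.
have [bA bK] : b \notin A /\ b \in K by move: bB; rewrite inE => /andP.
have key A1 : A1 \subset A -> A1 != finset.set0 -> a \notin A1 ->
    exists x y, [/\ x \in A1, y \in A :\: A1 & [set x; y] \in h].
  move=> sA1 A10 aA1.
  have A1K : A1 != K by apply: contraNneq aA1 => ->; apply: (subsetP sAK).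
  have [x [y [xA1]]] := conn A1 (subset_trans sA1 sAK) A10 A1K.
  rewrite !inE => /andP [yA1 yK] /orP [/eqP E|xyh].
    have : x \in [set a; b] by rewrite Ee -E !inE eqxx.
    have xA := subsetP sA1 _ xA1.
    rewrite !inE => /orP [] /eqP Ex; first by rewrite -Ex xA1 in aA1.
    by rewrite -Ex xA in bA.
  exists x, y; split=> //; rewrite inE yA1 /=; apply/negPn/negP => yA.
  by have := cutA x y (subsetP sA1 _ xA1); rewrite inE yA yK xyh => /(_ isT).
move=> A1 sA1 A10 A1A.
have [aA1|aA1] := boolP (a \in A1); last exact: key.
have [|||x [y [xA yA xy]]] := key (A :\: A1).
- exact: subsetDl.
- by rewrite setD_eq0; apply: contra A1A => sA; rewrite eqEsubset sA1.
- by rewrite inE aA1.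
exists y, x; split=> //; last by rewrite setUC.
by move: yA; rewrite setDDr setDv set0U inE => /andP [].
Qed.

Lemma decode_subset_cat h2 h1 acc c :
  {subset decode h1 acc c <= decode (h2 ++ h1) acc c}.
Proof. by elim: h2 => //= e h2 IH x /IH; apply: decode_subset. Qed.

Lemma card_cross A B : [disjoint A & B] ->
  #|[set [set x; y] | x in A, y in B]| = #|A| * #|B|.
Proof.
move=> dAB; rewrite curry_imset2X card_in_imset ?cardsX //.
move=> [x y] [x' y'] /setXP [/= xA yB] /setXP [/= xA' yB'] E.
have dis z : z \in A -> z \in B -> False.
  by move=> zA zB; move/pred0P: dAB => /(_ z); rewrite /= zA zB.
have : x \in [set x'; y'] by rewrite -E !inE eqxx.
have : y \in [set x'; y'] by rewrite -E !inE eqxx orbT.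
rewrite !inE => /orP [] /eqP Ey /orP [] /eqP Ex.
- by case: (dis y); rewrite // Ey.
- by case: (dis y); rewrite // Ey.
- by rewrite Ex Ey.
- by case: (dis x); rewrite // Ex.
Qed.

Lemma late_decode h r c (e : {set V}) :
  e \in late h r c -> e \subset decode h [:: r] c.
Proof.
have sub f h' : e \subset decode h' [:: r] c -> e \subset decode (f :: h') [:: r] c.
  by move=> /subsetP He; apply/subsetP => x /He; apply: decode_subset.
elim: h => //= f h IH; case: ifP => Hf; last by move/IH; apply: sub.
by rewrite inE => /orP [/eqP Ef|/IH]; apply: sub; rewrite // Ef.
Qed.

Lemma connected_or_cut K h : connected_in K h \/
  exists A, [/\ A \subset K, A != finset.set0, A != K, cut K A h & #|K :\: A| <= #|A|].
Proof.
pose cutb (A : {set V}) :=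
  [&& A \subset K, A != finset.set0, A != K &
      [forall a in A, forall b in K :\: A, [set a; b] \notin h]].
have [/existsP [A /and4P [sA A0 AK /forall_inP cA]]|no] := boolP [exists A, cutb A].
  right; have cutA : cut K A h by move=> a b aA; apply/forall_inP: b; apply: cA.
  have [le|lt] := leqP #|K :\: A| #|A|; first by exists A.
  have EA : K :\: (K :\: A) = A by rewrite setDDr setDv set0U; apply/setIidPr.
  exists (K :\: A); rewrite EA subsetDl (ltnW lt); split=> //.
  - by rewrite setD_eq0; apply: contra AK => sKA; rewrite eqEsubset sA.
  - by apply: contra A0 => /eqP E; rewrite -EA E setDv.
  - by move=> a b aA; rewrite EA => bA; rewrite setUC; apply: cutA.
left=> A sA A0 AK.
have : [exists a in A, exists b in K :\: A, [set a; b] \in h].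
  apply: contraR no => no; apply/existsP; exists A; rewrite /cutb sA A0 AK /=.
  apply/forall_inP => a aA; apply/forall_inP => b bA.
  apply: contra no => ab; apply/exists_inP; exists a => //.
  by apply/exists_inP; exists b.
by case/exists_inP=> a aA /exists_inP [b bB ab]; exists a, b.
Qed.

(* The exponent [(k - 1)(k - 2) / 3]: gluing [B] to a larger [A] leaves all the
   [|A| |B|] cross edges but one to be claimed later, and
   [m(a + b) <= m(a) + a b - 1] for [m(k) = (k - 1)(k - 2) / 3] and [b <= a]. *)
Lemma clique_code D h K h2 h1 :
  h = h2 ++ h1 -> K != finset.set0 ->
  (forall e : {set V}, e \subset K -> #|e| = 2 -> e \in h) ->
  (forall v, v \in K -> size (nbrs h v) <= D) -> connected_in K h1 ->
  exists r c, [/\ code_bounded #|K| D c, size c = #|K|.-1,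
    uniq (decode h1 [:: r] c), decode h1 [:: r] c =i K &
    #|K| ^ 2 + 2 <= 3 * #|[set e in late h r c]| + 3 * #|K| ].
Proof.
(* Time runs backwards: the latest edge [e] of [h1] is moved to [h2] until its removal disconnects
   [K]. *)
move=> Eh; elim: h1 h2 K Eh => [|e h1 IH] h2 K Eh K0 clq deg conn.
  have [r ->] := connected_nil conn K0.
  by exists r, [::]; rewrite cards1 /=; split=> // [x|]; rewrite ?inE //; lia.
have Eh' : h = rcons h2 e ++ h1 by rewrite cat_rcons.
have degs v : v \in K -> size (nbrs (e :: h1) v) <= D.
  move=> /deg; apply: leq_trans; rewrite !size_nbrs Eh count_cat; exact: leq_addl.
have [conn1|[A [sAK A0 AK cutA leA]]] := connected_or_cut K h1.
  have [r [c [bc sc uc Ec lc]]] := IH _ _ Eh' K0 clq deg conn1.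
  have full : decode (e :: h1) [:: r] c = decode h1 [:: r] c.
    apply: decode_full; rewrite /= sc -(card_uniqP uc) (eq_card Ec).
    by rewrite add1n prednK // card_gt0.
  by exists r, c; rewrite full.
have connA := connected_side sAK conn cutA A0 AK.
have clqA (f : {set V}) : f \subset A -> #|f| = 2 -> f \in h.
  by move=> fA; apply: clq; apply: subset_trans sAK.
have degA v : v \in A -> size (nbrs h v) <= D by move=> /(subsetP sAK) /deg.
have [r [c [bc sc uc Ec lc]]] := IH _ _ Eh' A0 clqA degA connA.
have szA : size (decode h1 [:: r] c) = #|A| by rewrite -(card_uniqP uc) (eq_card Ec).
have A1 : 0 < #|A| by rewrite card_gt0.
have full1 : size (decode h1 [:: r] c) = size [:: r] + size c.
  by rewrite szA /= sc add1n prednK.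
have fullA h' : decode (h' ++ h1) [:: r] c = decode h1 [:: r] c.
  exact: decode_full_cat.
(* The code of the larger side [A] is complete before [e]; the rest of [K] is named as soon as [e]
   is present. *)
have [||| c' [bc' sc' uc' Ec']] := decode_extend (acc := decode h1 [:: r] c) conn degs.
- exact: uc.
- by rewrite -size_eq0 szA -lt0n.
- by move=> x; rewrite Ec; apply: (subsetP sAK).
have Ecat : decode (e :: h1) [:: r] (c ++ c') = decode (e :: h1) (decode h1 [:: r] c) c'.
  by rewrite decode_cat_full (fullA [:: e]).
exists r, (c ++ c'); rewrite Ecat; split=> //.
- rewrite /code_bounded all_cat; apply/andP; split; last exact: bc'.
  apply: sub_all bc => q /andP [q1 ->]; rewrite andbT.
  exact: leq_trans q1 (subset_leq_card sAK).
- have : size (decode (e :: h1) (decode h1 [:: r] c) c') = #|K|.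
    by rewrite -(card_uniqP uc') (eq_card Ec').
  by rewrite sc' szA size_cat sc => <-; lia.
pose B := K :\: A.
have dAB : [disjoint A & B] by rewrite disjoint_sym disjoints_subset subsetDr.
have cB : #|K| = #|A| + #|B| by rewrite -(cardsID A K) (setIidPr sAK).
pose X := [set [set x; y] | x in A, y in B] :\ e.
have cX : #|A| * #|B| <= #|X|.+1.
  by rewrite -card_cross // /X (cardsD1 e) -add1n leq_add2r leq_b1.
(* By the cut, no cross edge is in [h1]; those other than [e] come after [e], when all of [K] is
   decoded, and so are late. *)
have sX : X \subset [set f in late h r (c ++ c')].
  apply/subsetP => f /setD1P [fe /imset2P [x y xA yB Ef]]; rewrite inE.
  have yK : y \in K /\ y \notin A by move: yB; rewrite inE => /andP [].
  have fK : f \subset K by rewrite Ef subUset !sub1set (subsetP sAK) // yK.1.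
  have f2 : #|f| = 2.
    rewrite Ef cards2; suff -> : x != y by [].
    by apply: contraNneq yK.2 => <-.
  have := clq f fK f2; rewrite Eh mem_cat inE (negPf fe) /= => /orP [fh2|fh1]; last first.
    by have := cutA x y xA yB; rewrite -Ef fh1.
  case/splitPr: fh2 => p1 p2; rewrite -catA /=; apply: mem_late.
  apply/subsetP => z /(subsetP fK) zK; apply: decode_subset_cat.
  by rewrite Ecat Ec'.
(* Late edges of [c] stay inside [A], so the two counts add up. *)
have dX : [disjoint [set f in late h r c] & X].
  rewrite disjoints_subset; apply/subsetP => f; rewrite !inE => /late_decode fA.
  apply/negP => /andP [_ /imset2P [x y xA yB Ef]].
  have := subsetP fA y; rewrite Ef Eh' fullA Ec !inE eqxx orbT => /(_ isT) yA.
  by move: yB; rewrite inE yA.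
have lL : #|[set f in late h r c]| + #|X| <= #|[set f in late h r (c ++ c')]|.
  rewrite -[X in _ + X]subn0 -(cards0 {set V}); have := cardsU [set f in late h r c] X.
  rewrite disjoint_setI0 // cards0 !subn0 => <-; apply: subset_leq_card.
  rewrite subUset sX andbT; apply/subsetP => f; rewrite !inE; exact: late_cat_sub.
have B0 : 0 < #|B|.
  by rewrite card_gt0 setD_eq0; apply: contra AK => sKA; rewrite eqEsubset sAK.
move: lc lL cX leA; rewrite -/B cB; move: #|A| #|B| #|X| #|_| #|_| A1 B0 => a b x l l'.
(* What remains is [b ^ 2 + 3 <= a * b + 3 * b], which follows from [1 <= b <= a]. *)
by move=> a0 b0 lc lL cX ba; rewrite -!mulnn in lc *; nia.
Qed.

End Decode.
Definition code_nat k D (s : seq ('I_k * 'I_D)) : seq (nat * nat) :=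
  [seq (val q.1, val q.2) | q <- s].

Lemma code_natP k D c : code_bounded k D c ->
  exists2 s : seq ('I_k * 'I_D), size s = size c & code_nat s = c.
Proof.
elim: c => [|[p l] c IH] /=; first by exists [::].
case/andP=> /= /andP [pk lD] /IH [s ss Es].
by exists ((Ordinal pk, Ordinal lD) :: s); rewrite /= ?ss // /code_nat /= -/(code_nat s) Es.
Qed.

(** The handshake identity. *)
Lemma sum_size_nbrs (V : finType) (h : seq {set V}) :
  (forall e, e \in h -> #|e| = 2) -> \sum_v size (nbrs h v) = 2 * size h.
Proof.
elim: h => [|e h IH] he.
  by rewrite muln0 big1 // => v _; rewrite size_nbrs.
have -> : 2 * size (e :: h) = #|e| + 2 * size h by rewrite he ?inE ?eqxx // mulnS.
rewrite -IH; last by move=> f fh; apply: he; rewrite inE fh orbT.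
rewrite -sum1_card [in RHS]big_mkcond -big_split /=; apply: eq_bigr => v _.
by rewrite !size_nbrs /=; case: (v \in e).
Qed.

(** * The total weight of all codes as potential *)

Section LowerBound.
Variables n k D : nat.
Implicit Types (h : seq {set 'I_n}) (W : {set {set 'I_n}}).

Definition code_type : finType := ('I_n * (k.-1).-tuple ('I_k * 'I_D))%type.

Definition code_weight h W (x : code_type) := weight h W x.1 (code_nat x.2).

(** The finished clique is connected in the whole history, so [clique_code] applies with no later
    edges. Client owns all its edges, so the weight is not zero. *)
Lemma good_clique_code h W (K : {set 'I_n}) :
  1 < k -> play_inv (K_edges n) h W -> #|K| = k -> {subset clique_edges K <= h} ->
  (forall v, v \in K -> size (nbrs h v) <= D) ->
  exists2 x : code_type, [set v in decode h [:: x.1] (code_nat x.2)] = K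
    & 2 ^ ((k.-1 * k.-2) %/ 3) <= code_weight h W x.
Proof.
move=> k1 [hE WE hW] cK clq deg.
have K0 : K != finset.set0 by rewrite -card_gt0 cK ltnW.
have clq2 (e : {set 'I_n}) : e \subset K -> #|e| = 2 -> e \in h.
  by move=> eK e2; apply: clq; rewrite inE eK e2.
have conn : connected_in K h.
  move=> A sA A0 AK; have [a aA] := set0Pn _ A0.
  have /set0Pn [b bB] : K :\: A != finset.set0.
    by rewrite setD_eq0; apply: contra AK => sKA; rewrite eqEsubset sA.
  exists a, b; split=> //; move: bB; rewrite inE => /andP [bA bK].
  apply: clq2; first by rewrite subUset !sub1set (subsetP sA) // bK.
  by rewrite cards2; case: eqP => // E; rewrite -E aA in bA.
have [r [c [bc sc uc Ec lc]]] := clique_code (h2 := [::]) erefl K0 clq2 deg conn.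
rewrite cK in bc sc lc.
have [s ss Es] := code_natP bc; rewrite sc in ss.
have /eqP ts := ss; exists (r, Tuple ts); rewrite /= /code_weight /= Es.
  by apply/setP => v; rewrite inE Ec.
rewrite /weight.
have -> : [forall e in W, ~~ (e \subset decode h [:: r] c)].
  apply/forall_inP => e eW; apply/negP => /subsetP se.
  have eh : e \in h.
    apply: clq2; first by apply/subsetP => x /se; rewrite Ec.
    by have := subsetP WE e eW; rewrite inE => /andP [_ /eqP].
  by have := hW e eh; rewrite eW.
rewrite leq_pexp2l //; apply: leq_trans (_ : #|[set e in late h r c]| <= _); last first.
  by rewrite cardsE card_size.
move: lc; move: #|_| => l lc; rewrite -ltnS ltn_divLR //.
by case: k k1 lc => [|[|j]] //= _; rewrite -mulnn; nia.
Qed.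

(** By the handshake identity at most [n / (2 k)] vertices have degree above [D], and each spoils at
    most one of the [n / k] cliques. The remaining cliques, at least [n / (2 k)] of them, have
    distinct heavy codes. *)
Lemma factor_weight t h W S :
  1 < k -> 4 * k * t <= n * D.+1 -> play_inv (K_edges n) h W -> size h <= t ->
  S \in Kk_factors n k -> {subset S <= h} ->
  2 ^ ((k.-1 * k.-2) %/ 3) * n <= 2 * k * \sum_x code_weight h W x.
Proof.
move=> k1 le_t inv szh /imsetP [P]; rewrite inE => /andP [pP /forall_inP cP] -> sub.
have [hE WE hW] := inv.
have [/eqP covP tiP nP] := and3P pP.
pose m := (k.-1 * k.-2) %/ 3.
pose bad := [set v | D < size (nbrs h v)].
pose good := [set B in P | [disjoint B & bad]].
pose X := [set x : code_type | 2 ^ m <= code_weight h W x].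
have goodX : #|good| <= #|X|.
  apply: leq_trans (leq_imset_card (fun x : code_type =>
    [set v in decode h [:: x.1] (code_nat x.2)]) X).
  apply/subset_leq_card/subsetP => B; rewrite inE => /andP [BP dB].
  have [|||x Ex wx] := @good_clique_code h W B k1 inv.
  - by apply/eqP/cP.
  - by move=> e eB; apply: sub; apply/bigcupP; exists B.
  - move=> v vB; rewrite leqNgt; apply/negP => vbad.
    by move/pred0P: dB => /(_ v); rewrite /= vB inE vbad.
  by apply/imsetP; exists x; rewrite ?inE.
have badP : #|P| <= #|good| + #|bad|.
  rewrite -(cardsID good P) leq_add //; first by rewrite subset_leq_card // subsetIr.
  apply: leq_trans (leq_imset_card (pblock P) bad).
  apply/subset_leq_card/subsetP => B; rewrite !inE => /andP [nB BP].
  rewrite BP /= in nB; have /pred0Pn [v /andP [/= vB vbad]] := nB.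
  by apply/imsetP; exists v; rewrite // (def_pblock tiP BP vB).
have cardP : #|P| * k = n.
  rewrite -(card_uniform_partition _ pP) ?cardsT ?card_ord //.
  by move=> B /cP /eqP.
have degs : #|bad| * D.+1 <= 2 * t.
  apply: leq_trans (_ : 2 * size h <= _); last by rewrite leq_mul2l szh orbT.
  rewrite -sum_size_nbrs; last first.
    by move=> e /hE; rewrite inE => /andP [_ /eqP].
  rewrite -sum_nat_const [leqRHS](bigID (mem bad)) /=; apply: leq_trans (leq_addr _ _).
  by apply: leq_sum => v; rewrite inE.
have sumX : 2 ^ m * #|X| <= \sum_x code_weight h W x.
  rewrite mulnC -sum_nat_const [leqRHS](bigID (mem X)) /=; apply: leq_trans (leq_addr _ _).
  by apply: leq_sum => x; rewrite inE.
rewrite -/m.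
have nX : n <= 2 * k * #|X|.
  move: goodX badP degs cardP le_t; move: #|good| #|X| #|bad| #|P| => g x b p.
  move=> gx pgb bD pk kt.
  have kb : 2 * k * b <= n.
    by rewrite -(leq_pmul2r (ltn0Sn D)); nia.
  by nia.
apply: leq_trans (_ : 2 ^ m * (2 * k * #|X|) <= _); first by rewrite leq_mul2l nX orbT.
by rewrite mulnCA leq_mul2l sumX orbT.
Qed.

(** Initially every code has weight 1, so the potential is [2 * k] times the number
    [n * (k * D) ^ k.-1] of codes; the factor [n] cancels. *)
Lemma WC_factor_lower t :
  1 < k -> 0 < n -> 4 * k * t <= n * D.+1 ->
  WC_wins_within (K_edges n) (Kk_factors n k) t finset.set0 finset.set0 ->
  2 ^ ((k.-1 * k.-2) %/ 3) <= 2 * k ^ k * D ^ k.-1.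
Proof.
move=> k1 n0 le_t win.
have E0 : finset.set0 = [set e in [::] : seq {set 'I_n}] by apply/setP => e; rewrite !inE.
have inv0 : play_inv (K_edges n) [::] finset.set0 by split=> //; rewrite sub0set.
rewrite {1}E0 in win.
have := @WC_potential _ _ _ (fun h W => 2 * k * \sum_x code_weight h W x)
  (2 ^ ((k.-1 * k.-2) %/ 3) * n) t _ _ t [::] finset.set0 inv0 (leqnn _) win.
have -> : \sum_x code_weight [::] finset.set0 x = n * (k * D) ^ k.-1.
  transitivity (\sum_(x : code_type) 1).
    apply: eq_bigr => x _; rewrite /code_weight /weight ifT //.
    by apply/forall_inP => e; rewrite inE.
  by rewrite sum1_card card_prod card_ord card_tuple card_prod !card_ord.
rewrite [n * _]mulnC mulnA leq_pmul2r // expnMn mulnA.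
rewrite -[2 * k * _]mulnA -expnS prednK ?(ltnW k1) //; apply.
- move=> h W e1 e2 _ ne _ _; rewrite -mulnDr mulnCA leq_mul2l -big_split big_distrr /=.
  by apply/orP; right; apply: leq_sum => x _; apply: weight_step.
- by move=> h W S inv sz SF sub; apply: (factor_weight (t := t) _ _ _ _ SF).
Qed.

End LowerBound.

(** * Numerical estimates *)

Definition log_loss (k : nat) : nat := 8 + 3 * trunc_log 2 k.

(** A square-root bound is crude for a logarithm, but suffices for [o(k)]. *)
Lemma log_loss_sqr k : (0 < k)%N -> (log_loss k ^ 2 <= 128 * k)%N.
Proof.
move=> k0; have H L : ((8 + 3 * L) ^ 2 <= 128 * 2 ^ L)%N.
  elim: L => // L IH; rewrite [2 ^ L.+1]expnS mulnCA.
  by apply: leq_trans (leq_mul (leqnn 2) IH); rewrite -!mulnn; lia.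
by apply: leq_trans (H _) _; rewrite leq_mul2l trunc_logP.
Qed.

(** In [log_loss], the constant is [8 = 5 + 3]: 5 accounts for the factor 32, and 3 for the rounding
    down of the logarithm. *)
Lemma expn_log_loss k : (32 * k ^ 3 <= 2 ^ log_loss k)%N.
Proof.
have lt : (k < 2 ^ (trunc_log 2 k).+1)%N by apply: trunc_log_ltn.
have : (k ^ 3 <= (2 ^ (trunc_log 2 k).+1) ^ 3)%N by rewrite leq_exp2r // ltnW.
have -> : log_loss k = (5 + (trunc_log 2 k).+1 * 3)%N by rewrite /log_loss; lia.
by rewrite expnD expnM => H; apply: leq_mul.
Qed.

(** The hypothesis is the cube of [D <= 4 k 2 ^ (k / 3 - log_loss k)], and everything is cubed to
    keep exponents integral. The conclusion contradicts [WC_factor_lower]. *)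
Lemma codes_lt_weight k D : (1 < k)%N ->
  (D ^ 3 * (2 ^ log_loss k) ^ 3 <= (4 * k) ^ 3 * 2 ^ k)%N ->
  (2 * k ^ k * D ^ k.-1 < 2 ^ ((k.-1 * k.-2) %/ 3))%N.
Proof.
move=> k1 HD; have k0 : (0 < k)%N by apply: ltnW.
have H1 : (D ^ 3 * k ^ 6 * 2 ^ 9 <= 2 ^ k)%N.
  have k3 : (0 < 4 ^ 3 * k ^ 3)%N by rewrite muln_gt0 !expn_gt0 k0.
  rewrite -(leq_pmul2l k3).
  apply: leq_trans (_ : D ^ 3 * (32 * k ^ 3) ^ 3 <= _)%N; last first.
    apply: leq_trans (_ : D ^ 3 * (2 ^ log_loss k) ^ 3 <= _)%N; last first.
      by rewrite -[(4 ^ 3 * _)%N]expnMn.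
    by rewrite leq_mul2l leq_exp2r // expn_log_loss orbT.
  rewrite expnMn -!expnM (_ : (3 * 3 = 3 + 6)%N) // expnD.
  by move: (expn D 3) (expn k 3) (expn k 6) => x y z; lia.
have H2 : (D ^ (3 * k.-1) * k ^ (6 * k.-1) * 2 ^ (9 * k.-1) <= 2 ^ (k * k.-1))%N.
  by rewrite !expnM -!expnMn leq_exp2r //; lia.
have H3 : (k ^ (3 * k) <= k ^ (6 * k.-1))%N by rewrite leq_pexp2l //; lia.
have H4 : ((2 * k ^ k * D ^ k.-1) ^ 3 * 2 ^ (9 * k.-1) <= 2 ^ (3 + k * k.-1))%N.
  rewrite expnD; apply: leq_trans (leq_mul (leqnn _) H2).
  rewrite !expnMn -!expnM ![(_ * 3)%N]mulnC -!mulnA; do 3!apply: leq_mul => //.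
  by rewrite mulnCA leq_mul2l leq_mul2r H3 !orbT.
rewrite -(ltn_exp2r _ _ (isT : (0 < 3)%N)) -expnM.
have p9 : (0 < 2 ^ (9 * k.-1))%N by rewrite expn_gt0.
rewrite -(ltn_pmul2r p9) -expnD; apply: leq_ltn_trans H4 _; rewrite ltn_exp2l //.
have := ltn_ceil (k.-1 * k.-2) (isT : (0 < 3)%N); move: (_ %/ 3)%N => q.
(* The surplus [9 (k - 1)] covers the gap between [k (k - 1)] and [(k - 1)(k - 2)], the cubed factor
   2 and the rounding in the division by 3. *)
by case: k k1 {HD k0 H1 H2 H3 p9} => [|[|j]] //= _ H; nia.
Qed.

(* Asymptotics and the bounds over the reals *)
From mathcomp Require Import all_boot all_order all_algebra.
From mathcomp Require Import all_classical all_reals all_analysis.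

Import Order.TTheory GRing.Theory Num.Theory.
Import numFieldNormedType.Exports.

Local Open Scope classical_set_scope.
Local Open Scope ring_scope.

Lemma log_loss_littleo (R : realType) :
  (fun k : nat => (log_loss k)%:R : R) =o_\oo (fun k : nat => k%:R : R).
Proof.
apply/eqoP => e e0; near=> k.
(* After squaring, the claim follows from [128 k <= e ^ 2 k ^ 2]. *)
have ke : 128 / e ^+ 2 <= k%:R :> R by near: k; exact: nbhs_infty_ger.
have k1 : 1 <= k%:R :> R by near: k; exact: nbhs_infty_ger.
rewrite !ger0_norm ?ler0n //.
rewrite -(@ler_pXn2r _ 2) ?nnegrE ?ler0n ?mulr_ge0 ?(ltW e0) //.
have k0 : (0 < k)%N by rewrite -(ler_nat R).
have := log_loss_sqr k0; rewrite -(ler_nat R) natrX natrM => /le_trans; apply.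
rewrite exprMn expr2 mulrA ler_pM2r ?ltr0n //.
by move: ke; rewrite ler_pdivrMr ?exprn_gt0 // mulrC.
Unshelve. all: by end_near. Qed.

Lemma tau_lower (R : realType) (n k : nat) : (2 <= k)%N -> (0 < n)%N ->
  ((2 `^ (k%:R / 3 - (log_loss k)%:R) * n%:R)%:E
     <= tau_WC (K_edges n) (Kk_factors n k) R)%E.
Proof.
move=> k2 n0; apply: le_ereal_inf_tmp => _ [t win <-]; rewrite lee_fin leNgt.
set x := 2 `^ _; apply/negP => lt_t.
have x0 : 0 < x by rewrite powR_gt0.
pose y := 4 * k%:R * x; have y0 : 0 <= y by rewrite !mulr_ge0 ?ler0n // ltW.
(* Rounding down serves both needs: [D <= y] keeps the codes few, and [y < D + 1] makes vertices of
   degree above [D] rare. *)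
pose D := Num.trunc y.
have Dy : D%:R <= y by rewrite truncn_le.
have yD : y < D.+1%:R by rewrite -truncn_le_nat.
have le_t : (4 * k * t <= n * D.+1)%N.
  rewrite -(ler_nat R) !natrM.
  apply: (@le_trans _ _ (4 * k%:R * (x * n%:R))).
    by apply: ler_wpM2l; [rewrite mulr_ge0 ?ler0n | exact: ltW].
  by rewrite mulrA [n%:R * _]mulrC ler_wpM2r ?ler0n // ltW.
have := WC_factor_lower k2 n0 le_t win; rewrite leqNgt => /negP; apply.
apply: codes_lt_weight => //.
rewrite -(ler_nat R) [leLHS]natrM [leRHS]natrM !natrX [(4 * k)%:R]natrM.
have xE : x * 2 ^+ log_loss k = 2 `^ (k%:R / 3).
  by rewrite /x powRB ?pnatr_eq0 ?implybT // powR_mulrn ?ler0n // divfK // expf_neq0 ?pnatr_eq0.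
have x3 : (2 `^ (k%:R / 3)) ^+ 3 = 2 ^+ k :> R.
  by rewrite -powR_mulrn ?powR_ge0 // -powRrM divfK ?pnatr_eq0 // powR_mulrn ?ler0n.
have p0 : 0 <= 2 ^+ log_loss k :> R by apply: exprn_ge0.
rewrite -x3 -xE; move: (2 ^+ log_loss k) p0 => p p0.
rewrite -!exprMn lerXn2r ?nnegrE ?mulr_ge0 ?ler0n ?(ltW x0) //.
by rewrite [leRHS]mulrA ler_wpM2r.
Qed.

Lemma tau_upper (R : realType) (n k : nat) : (2 <= k)%N -> (k %| n)%N ->
  (k * 2 ^ absorber_size k + 2 ^ absorber_size k + 2 ^ k <= n)%N ->
  (tau_WC (K_edges n) (Kk_factors n k) R
     <= (2 ^+ k * (n%:R / k%:R) + (2 ^ absorber_size k + k.-1 * 2 ^ k)%N%:R)%:E)%E.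
Proof.
move=> k2 dk len.
apply: ge_ereal_inf; eexists; first by eexists; first exact: Kk_factor_within k2 dk len.
rewrite lee_fin addnCA natrD lerD2r natrM natrX ler_wpM2l ?exprn_ge0 ?ler0n //.
by rewrite ler_pdivlMr ?ltr0n ?(ltnW k2) // -natrM ler_nat leq_divM.
Qed.

Theorem theorem2 (R : realType) :
  exists (n0 : nat -> nat) (C f : nat -> R),
    f =o_\oo (fun k : nat => k%:R : R) /\
    forall k n : nat, (2 <= k)%N -> (n0 k <= n)%N -> (k %| n)%N ->
      ((2 `^ (k%:R / 3 - f k) * n%:R)%:E
         <= tau_WC (K_edges n) (Kk_factors n k) R)%E /\
      (tau_WC (K_edges n) (Kk_factors n k) R
         <= (2 ^+ k * (n%:R / k%:R) + C k)%:E)%E.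
Proof.
exists (fun k => k * 2 ^ absorber_size k + 2 ^ absorber_size k + 2 ^ k)%N.
exists (fun k => (2 ^ absorber_size k + k.-1 * 2 ^ k)%N%:R).
exists (fun k => (log_loss k)%:R); split; first exact: log_loss_littleo.
move=> k n k2 len dk; split; last exact: tau_upper.
by apply: tau_lower => //; apply: leq_trans len; rewrite addn_gt0 expn_gt0 orbT.
Qed.
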